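(* Let $f(\lambda)$ and $g(\lambda)$ be analytic at $\lambda_0\in\mathbb{C}$ with $f(\lambda_0)\ne0$ and $g(\lambda_0)=0$. If $\lambda_0$ is a zero of $g(\lambda)$ of order $n$, so that $f(\lambda)/g(\lambda)$ has a pole of order $n$ at $\lambda_0$, then $$\operatorname*{reglim}_{\lambda\to\lambda_0}\frac{f(\lambda)}{g(\lambda)}=\left(\frac{n!}{g^{(n)}(\lambda_0)}\right)^{n+1}\det\Delta^{(n)}(\lambda_0),$$ where $\Delta^{(n)}(\lambda_0)$ is the $(n+1)\times(n+1)$ matrix $$\Delta^{(n)}(\lambda_0)=\begin{bmatrix}\frac{g^{(n)}(\lambda_0)}{n!}&0&0&\cdots&\frac{f(\lambda_0)}{0!}\\ \frac{g^{(n+1)}(\lambda_0)}{(n+1)!}&\frac{g^{(n)}(\lambda_0)}{n!}&0&\cdots&\frac{f^{(1)}(\lambda_0)}{1!}\\ \frac{g^{(n+2)}(\lambda_0)}{(n+2)!}&\frac{g^{(n+1)}(\lambda_0)}{(n+1)!}&\frac{g^{(n)}(\lambda_0)}{n!}&\cdots&\frac{f^{(2)}(\lambda_0)}{2!}\\ \vdots&\vdots&\vdots&\vdots&\vdots\\ \frac{g^{(2n)}(\lambda_0)}{(2n)!}&\frac{g^{(2n-1)}(\lambda_0)}{(2n-1)!}&\frac{g^{(2n-2)}(\lambda_0)}{(2n-2)!}&\cdots&\frac{f^{(n)}(\lambda_0)}{n!}\end{bmatrix},$$ that is, with rows and columns indexed by $0,\dots,n$, the entry in row $i$ and column $j\le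 n-1$ is $\frac{g^{(n+i-j)}(\lambda_0)}{(n+i-j)!}$ if $i\ge j$ and $0$ if $i<j$, and the entry in row $i$ and column $n$ is $\frac{f^{(i)}(\lambda_0)}{i!}$. Equivalently, $$\operatorname*{reglim}_{\lambda\to\lambda_0}\frac{f(\lambda)}{g(\lambda)}=\frac{f^{(n)}(\lambda_0)}{g^{(n)}(\lambda_0)}+\left(\frac{n!}{g^{(n)}(\lambda_0)}\right)^{n+1}\sum_{k=0}^{n-1}\frac{f^{(k)}(\lambda_0)}{k!}\,C_{kn}(\lambda_0),$$ where $C_{kn}(\lambda_0)$ is the cofactor of the element $f^{(k)}(\lambda_0)/k!$ (row $k$, last column) of the matrix $\Delta^{(n)}(\lambda_0)$.
   Context: Regularized limit: if $w$ is analytic in a punctured disk around $\lambda_0$ with Laurent expansion $\sum_{k\in\mathbb{Z}}a_k(\lambda-\lambda_0)^k$ there, and $w_P(\lambda|\lambda_0)=\sum_{k\ge1}a_{-k}(\lambda-\lambda_0)^{-k}$ is its principal part, then $\operatorname{reglim}_{\lambda\to\lambda_0}w(\lambda)=\lim_{\lambda\to\lambda_0}[w(\lambda)-w_P(\lambda|\lambda_0)]$. *)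

(* Defs.v *)
From HB Require Import structures.
From mathcomp Require Import all_boot all_order all_algebra.
From mathcomp Require Import complex.
From mathcomp Require Import boolp classical_sets functions reals.
From mathcomp Require Import topology normedtype sequences derive.

Set Implicit Arguments.
Unset Strict Implicit.
Unset Printing Implicit Defensive.

Import Order.TTheory GRing.Theory Num.Theory.
Import numFieldNormedType.Exports.

Local Open Scope ring_scope.
Local Open Scope classical_set_scope.

(* R[i] viewed as a numeric field: MathComp-Analysis puts the topology given by
   the modulus on every numFieldType, but this is not inferred from the bare
   type R[i].  With K := complexField R, derive1 is the complex derivative. *)
Definition complexField (R : realType) : numFieldType := R[i]%C.

Section RegularizedLimit.
Variable K : numFieldType.
Implicit Types (f g w : K -> K) (a : int -> K) (n : nat).

Definition analytic_at f (z0 : K) : Prop :=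
  exists c : nat -> K, \forall z \near z0,
    series (fun k => c k * (z - z0) ^+ k) @ \oo --> f z.

Definition zero_of_order g (z0 : K) n : Prop :=
  (forall k, (k < n)%N -> derive1n k g z0 = 0) /\ derive1n n g z0 != 0.

(* The terms a_{-k} (z - z0)^{-k} for k >= 1, shifted to start at index 0. *)
Definition principal_series a (z0 z : K) : nat -> K :=
  series (fun k => a (- k.+1%:Z) * (z - z0) ^- k.+1).

Definition principal_part a (z0 z : K) : K := limn (principal_series a z0 z).

Definition regular_series a (z0 z : K) : nat -> K :=
  series (fun k => a k%:Z * (z - z0) ^+ k).

(* A bilateral series converges when both of its halves do; a punctured
   neighborhood of z0 contains a punctured disk, and conversely. *)
Definition laurent_expansion w (z0 : K) a : Prop :=
  \forall z \near z0^',
    cvgn (principal_series a z0 z) /\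
    regular_series a z0 z @ \oo --> w z - principal_part a z0 z.

(* is_reglim w z0 l : the regularized limit of w at z0 exists and is l.
   Over the complex numbers, w and z0 determine the coefficients a uniquely. *)
Definition is_reglim w (z0 l : K) : Prop :=
  exists2 a, laurent_expansion w z0 a &
    w z - principal_part a z0 z @[z --> z0^'] --> l.

Definition pole_of_order w (z0 : K) n : Prop :=
  (0 < n)%N /\
  exists2 a, laurent_expansion w z0 a &
    a (- n%:Z) != 0 /\ forall k, (n < k)%N -> a (- k%:Z) = 0.

Definition taylor_coef f (z0 : K) n : K := derive1n n f z0 / (n`!)%:R.

Definition Delta f g (z0 : K) n : 'M[K]_n.+1 :=
  \matrix_(i, j)
    if (j < n)%N then
      if (j <= i)%N then taylor_coef g z0 (n + i - j)%N else 0
    else taylor_coef f z0 i.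

End RegularizedLimit.

(* Main.v *)
Require Import Defs.
From HB Require Import structures.
From mathcomp Require Import all_boot all_order all_algebra.
From mathcomp Require Import complex ring.
From mathcomp Require Import boolp classical_sets functions reals.
From mathcomp Require Import topology normedtype sequences derive.

Set Implicit Arguments.
Unset Strict Implicit.
Unset Printing Implicit Defensive.

Import Order.TTheory GRing.Theory Num.Theory.
Import numFieldNormedType.Exports.

Local Open Scope ring_scope.
Local Open Scope classical_set_scope.

(** Write [w = z - z0].  Near [z0] the function [f] is the sum of its Taylor
series [c_0 + c_1 w + ...], and [g] is [w ^+ n] times a power series
[d_0 + d_1 w + ...] with [d_0 != 0].  The formal quotient
[h_0 + h_1 w + ...] of these two series, determined by the triangular system
[h_0 d_k + ... + h_k d_0 = c_k], converges near [z0]; hence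
[f z / g z = w ^- n * (h_0 + h_1 w + ...)].  This is the Laurent expansion of
[f / g]: its coefficient of index [m] is [h_(n + m)], the leading one
[h_0 = c_0 / d_0] is nonzero, and what remains after removing the principal
part is a power series in [w] with constant term [h_n].  So the regularized
limit is [h_n], and Cramer's rule for the first [n + 1] equations of the
triangular system writes [h_n] as the determinant of [Delta] divided by
[d_0 ^+ n.+1].  The second formula is the expansion of that determinant along
its last column, where the cofactor of the bottom entry is [d_0 ^+ n].

All of the analysis rests on geometric bounds [`|c k| <= M * B ^+ k]
([dominated]).  A power series that converges near its centre has such
coefficients ([dominated_of_cvg_series]); conversely such a bound makes the
series converge near the centre and controls its tails
([power_series_tail_le]).  These bounds give differentiation term by term
([cvg_series_derive1]), hence the identification of the coefficients with the
Taylor coefficients ([taylor_coefE]), and they are inherited by the formal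
quotient ([dominated_quotient]), whose product with the denominator is then
shown to converge to the numerator ([power_series_quotient]).

The one property of the complex numbers needed beyond the axioms of a numeric
field is that geometrically dominated series converge ([cvg_of_dominated]);
it is isolated as a hypothesis and obtained for the complex numbers from the
convergence of the real and imaginary parts. *)

(** * Geometrically dominated sequences *)

Definition dominated (K : numDomainType) (c : nat -> K) (M B : K) : Prop :=
  forall k, `|c k| <= M * B ^+ k.

(** The fragment of completeness that power series need: the ratio is fixed to
one half because the radius of convergence may always be shrunk.  Taken with
[x k = 2^-1 ^+ k] it also provides an archimedean property. *)
Definition cvg_of_dominated (K : numFieldType) : Prop :=
  forall (x : nat -> K) (M : K), dominated x M 2^-1 -> cvgn (series x).

Section GeometricDomination.
Context {K : numFieldType}.
Implicit Types (c x : nat -> K) (M B q : K).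

Lemma dominated_ge0 c M B : dominated c M B -> 0 <= M.
Proof. by move=> /(_ 0%N); rewrite expr0 mulr1; apply: le_trans. Qed.

Lemma dominatedW c M B M' B' : 0 <= M -> 0 <= B -> M <= M' -> B <= B' ->
  dominated c M B -> dominated c M' B'.
Proof.
move=> M0 B0 MM' BB' cMB k; apply: (le_trans (cMB k)).
by apply: ler_pM => //; [exact: exprn_ge0|rewrite lerXn2r// nnegrE (le_trans B0)].
Qed.

Lemma dominated_geometric c M B (w : K) : dominated c M B ->
  dominated (fun k => c k * w ^+ k) M (B * `|w|).
Proof. by move=> cMB k; rewrite normrM normrX exprMn mulrA ler_wpM2r ?exprn_ge0. Qed.

Lemma dominated_shift c M B n : dominated c M B ->
  dominated (fun k => c (n + k)%N) (M * B ^+ n) B.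
Proof. by move=> cMB k; rewrite -mulrA -exprD. Qed.

Lemma natr_le_2expn k : k%:R <= 2 ^+ k :> K.
Proof. by rewrite -natrX ler_nat ltnW// ltn_expl. Qed.

Lemma geometric_tail q N m : 0 <= q -> q <= 2^-1 ->
  \sum_(k < m) q ^+ (N + k) <= 2 * q ^+ N.
Proof.
move=> q0 q12.
(* Doubling the first omitted term gives a bound stable under induction. *)
suff : \sum_(k < m) q ^+ (N + k) + 2 * q ^+ (N + m) <= 2 * q ^+ N.
  by apply: le_trans; rewrite lerDl mulr_ge0// exprn_ge0.
elim: m => [|m IHm]; first by rewrite big_ord0 add0r addn0.
apply: le_trans IHm; rewrite big_ord_recr/= -addrA lerD2l addnS exprSr.
rewrite mulrCA [leRHS]mulr_natl [leRHS]mulr2n lerD2l.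
rewrite -[leRHS]mulr1 ler_wpM2l ?exprn_ge0//.
by rewrite mulrC -ler_pdivlMr ?ltr0n// mul1r.
Qed.

(** With ratio at most one half, a geometric tail is at most twice its first
term; the bound passes to the limit of the partial sums. *)
Lemma series_tail_le x M q l N : 0 <= q -> q <= 2^-1 -> dominated x M q ->
  series x @ \oo --> l -> `|l - series x N| <= 2 * M * q ^+ N.
Proof.
move=> q0 q12 xMq xl; apply/ler_addgt0Pr => e e0.
have M0 := dominated_ge0 xMq.
near \oo => m.
have Nm : (N <= m)%N by near: m; exact: nbhs_infty_ge.
have -> : l - series x N = (l - series x m) + (series x m - series x N) by ring.
rewrite addrC (le_trans (ler_normD _ _))// lerD//; last first.
  by near: m; exact: cvgr_dist_le.
rewrite sub_series_geq// (le_trans (ler_norm_sum _ _ _))//.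
apply: (@le_trans _ _ (\sum_(N <= k < m) M * q ^+ k)); first exact: ler_sum.
rewrite -mulr_sumr -{1}[N]add0n big_addn big_mkord.
under eq_bigr do rewrite addnC.
by rewrite [2 * M]mulrC -mulrA ler_wpM2l// geometric_tail.
Unshelve. all: by end_near. Qed.

(** Convergence at a single point [z0 + r] with [r > 0] bounds the terms
[c k * r ^+ k], hence [c] by a geometric sequence of ratio [r^-1]. *)
Lemma dominated_of_cvg_series c (f : K -> K) (z0 : K) :
  (\forall z \near z0, series (fun k => c k * (z - z0) ^+ k) @ \oo --> f z) ->
  exists M B, [/\ 0 < M, 0 < B & dominated c M B].
Proof.
move=> /nbhs_ballP[e /= e0 ce]; pose r := e / 2.
have r0 : 0 < r by rewrite divr_gt0.
have zr : ball z0 e (z0 + r).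
  rewrite -ball_normE /ball_/= opprD addrA subrr add0r normrN gtr0_norm//.
  by rewrite ltr_pdivrMr// mulr_natr mulr2n ltrDl.
have /cvgP/cvg_series_cvg_0 := ce _ zr.
rewrite [_ - z0]addrC addKr => /cvgP/cvg_seq_bounded /pinfty_ex_gt0[M M0 cM].
exists M, r^-1; split => //; first by rewrite invr_gt0.
move=> k; have /= := cM k I; rewrite normrM normrX (gtr0_norm r0).
by rewrite exprVn -ler_pdivlMr ?exprn_gt0.
Qed.

Lemma power_series_tail_le c M B (w l : K) N :
  0 <= B -> B * `|w| <= 2^-1 -> dominated c M B ->
  series (fun k => c k * w ^+ k) @ \oo --> l ->
  `|l - series (fun k => c k * w ^+ k) N| <= 2 * M * (B * `|w|) ^+ N.
Proof.
move=> B0 Bw cMB; apply: series_tail_le => //; first by rewrite mulr_ge0.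
exact: dominated_geometric.
Qed.

Lemma near_small_dist (z0 : K) B r : 0 <= B -> 0 < r ->
  \forall z \near z0, B * `|z - z0| <= r.
Proof.
move=> B0 r0; near=> z.
have h : `|z - z0| <= r / (B + 1).
  near: z; apply: (@cvgr_distC_le _ _ _ _ _ id) => //.
  by rewrite divr_gt0// ltr_wpDl.
rewrite (le_trans (ler_wpM2l B0 h))// mulrCA ger_pMr//.
by rewrite ler_pdivrMr ?ltr_wpDl// mul1r lerDl.
Unshelve. all: by end_near. Qed.

(** The tail estimate after one term bounds [f z - c 0] by a multiple of
[z - z0].  The punctured neighborhood matters: this is applied to functions
such as a quotient by a power of [z - z0], whose value at [z0] is arbitrary. *)
Lemma power_series_cvg_center c M B (f : K -> K) (z0 : K) :
  0 <= B -> dominated c M B ->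
  (\forall z \near z0^', series (fun k => c k * (z - z0) ^+ k) @ \oo --> f z) ->
  f z @[z --> z0^'] --> c 0%N.
Proof.
move=> B0 cMB cf; apply/cvgrPdist_le => e e0.
have M0 := dominated_ge0 cMB.
near=> z; rewrite distrC.
have <- : series (fun k => c k * (z - z0) ^+ k) 1 = c 0%N.
  by rewrite /series/= big_nat1 expr0 mulr1.
have h : `|f z - series (fun k => c k * (z - z0) ^+ k) 1| <=
    2 * M * (B * `|z - z0|) ^+ 1.
  apply: power_series_tail_le => //; last by near: z.
  by near: z; apply: nbhs_dnbhs; apply: near_small_dist; rewrite ?invr_gt0.
apply: (le_trans h); rewrite expr1 mulrA.
near: z; apply: nbhs_dnbhs; apply: near_small_dist => //.
by rewrite !mulr_ge0.
Unshelve. all: by end_near. Qed.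

End GeometricDomination.

(** * Termwise differentiation of power series *)

Section PowerSeries.
Context {K : numFieldType} (K_cvg : cvg_of_dominated K).
Implicit Types (c : nat -> K) (M B : K).

Lemma cvg_power_series c M B (w : K) : 0 <= B -> B * `|w| <= 2^-1 ->
  dominated c M B -> cvgn (series (fun k => c k * w ^+ k)).
Proof.
move=> B0 Bw cMB; apply: (K_cvg (M := M)).
have M0 := dominated_ge0 cMB.
by apply: dominatedW (dominated_geometric w cMB); rewrite ?mulr_ge0.
Qed.

(** With [E_k] the remainder inside the norm, one has
[E_(k+1) = (w + h) E_k + h^2 k w^(k-1)], which is bounded by induction.  The
factor [s ^+ 2] on the left avoids negative exponents of [s] on the right. *)
Lemma expr_taylor1_le (w h s : K) k : 0 <= s -> `|w| <= s -> `|w + h| <= s ->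
  s ^+ 2 * `|(w + h) ^+ k - w ^+ k - h * (w ^+ k.-1 *+ k)| <=
  `|h| ^+ 2 * (4 * s) ^+ k.
Proof.
move=> s0 ws whs; elim: k => [|k IHk].
  by rewrite mulr0n mulr0 !expr0 subrr subr0 normr0 mulr0 mulr1 exprn_ge0.
have -> : (w + h) ^+ k.+1 - w ^+ k.+1 - h * (w ^+ k *+ k.+1) =
    (w + h) * ((w + h) ^+ k - w ^+ k - h * (w ^+ k.-1 *+ k)) +
    h ^+ 2 * (w ^+ k.-1 *+ k).
  case: k {IHk} => [|k] /=; first by rewrite !expr0 !mulr0n; ring.
  rewrite -[_ *+ k.+1]mulr_natr -[_ *+ k.+2]mulr_natr -[k.+2%:R]natr1 !exprS.
  by move: (k.+1%:R) (w ^+ k) ((w + h) ^+ k) => a b d; ring.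
apply: (le_trans (ler_wpM2l (exprn_ge0 2 s0) (ler_normD _ _))).
rewrite mulrDr !normrM normrMn !normrX.
apply: (@le_trans _ _ (`|h| ^+ 2 * (4 * s) ^+ k * s +
                       `|h| ^+ 2 * (4 * s) ^+ k * s)).
  apply: lerD.
    rewrite mulrCA mulrC.
    by apply: ler_pM => //; rewrite mulr_ge0 ?exprn_ge0.
  rewrite mulrCA -mulrA ler_wpM2l ?exprn_ge0 ?mulr_ge0//.
  case: k {IHk} => [|k] /=; first by rewrite mulr0 expr0 mul1r.
  apply: (@le_trans _ _ (s ^+ 2 * (s ^+ k * k.+1%:R))).
    by rewrite ler_wpM2l ?exprn_ge0// -[leLHS]mulr_natr ler_wpM2r// lerXn2r// nnegrE.
  rewrite mulrA -exprD mulrC exprMn -mulrA -exprSr ler_wpM2r ?exprn_ge0//.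
  rewrite (le_trans (natr_le_2expn _))// lerXn2r// ?nnegrE//.
  by rewrite ler_nat.
rewrite -mulrDr -mulrA ler_wpM2l ?exprn_ge0// exprSr.
rewrite ler_wpM2l ?exprn_ge0 ?mulr_ge0// -mulr2n -[leLHS]mulr_natl ler_wpM2r//.
by rewrite ler_nat.
Qed.

Definition deriv_coef c : nat -> K := fun k => c k.+1 *+ k.+1.

Lemma dominated_deriv_coef c M B : 0 <= M -> 0 <= B -> dominated c M B ->
  dominated (deriv_coef c) (2 * M * B) (2 * B).
Proof.
move=> M0 B0 cMB k; rewrite /deriv_coef normrMn -[leLHS]mulr_natl.
apply: (le_trans (ler_pM _ _ (natr_le_2expn k.+1) (cMB k.+1))) => //.
by rewrite exprMn !exprS le_eqVlt; apply/orP; left; apply/eqP; ring.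
Qed.

(** The left-hand side is the sum of the first-order Taylor remainders of the
terms [c k * w ^+ k].  By [expr_taylor1_le] they decrease geometrically, with
[`|h| ^+ 2] in factor. *)
Lemma power_series_diff_quot_le c M B (w h F Fh D : K) :
  0 < B -> B * `|w| <= 8^-1 -> B * `|w + h| <= 8^-1 -> dominated c M B ->
  series (fun k => c k * w ^+ k) @ \oo --> F ->
  series (fun k => c k * (w + h) ^+ k) @ \oo --> Fh ->
  series (fun k => deriv_coef c k * w ^+ k) @ \oo --> D ->
  `|Fh - F - h * D| <= 2 * (M * (8 * B) ^+ 2) * `|h| ^+ 2.
Proof.
move=> B0 Bw Bwh cMB cF cFh cD.
have M0 := dominated_ge0 cMB.
pose x k := c k * (w + h) ^+ k - c k * w ^+ k - h * (c k * (w ^+ k.-1 *+ k)).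
(* This radius makes the ratio [B * (4 * s)] equal to one half. *)
pose s := (8 * B)^-1.
have s0 : 0 < s by rewrite invr_gt0 mulr_gt0.
have les (y : K) : B * `|y| <= 8^-1 -> `|y| <= s.
  by rewrite /s invfM -ler_pdivlMl// mulrC.
have xD : dominated x (M * (8 * B) ^+ 2 * `|h| ^+ 2) 2^-1.
  move=> k; rewrite (_ : x k = c k * ((w + h) ^+ k - w ^+ k - h * (w ^+ k.-1 *+ k)));
    last by rewrite /x; ring.
  rewrite normrM.
  have E := expr_taylor1_le k (ltW s0) (les _ Bw) (les _ Bwh).
  rewrite -ler_pdivlMl ?exprn_gt0// in E.
  apply: (le_trans (ler_pM _ _ (cMB k) E)) => //.
  have -> : 2^-1 = B * (4 * s) :> K.
    by rewrite /s; field; rewrite ?lt0r_neq0.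
  have -> : (s ^+ 2)^-1 = (8 * B) ^+ 2 by rewrite -exprVn invrK.
  rewrite (exprMn _ B) le_eqVlt; apply/orP; left; apply/eqP.
  by move: (B ^+ k) ((4 * s) ^+ k) (8 * B) => a b d; ring.
have xl : series x @ \oo --> Fh - F - h * D.
  have -> : series x = fun N => series (fun k => c k * (w + h) ^+ k) N -
      series (fun k => c k * w ^+ k) N -
      h * series (fun k => c k * (w ^+ k.-1 *+ k)) N.
    apply/funext => N; rewrite /series/= mulr_sumr -!sumrB.
    by apply: eq_bigr.
  apply: cvgB; first exact: cvgB.
  apply: cvgMr.
  rewrite -cvg_shiftS; apply: cvg_trans cD; apply: near_eq_cvg; near=> N.
  rewrite /series/= big_nat_recl//= mulr0n mulr0 add0r.
  by apply: eq_bigr => k _; rewrite /deriv_coef mulrnAr mulrnAl.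
have half0 : 0 <= 2^-1 :> K by rewrite invr_ge0.
have := series_tail_le 0 half0 (lexx _) xD xl.
by rewrite /series/= big_geq// subr0 expr0 mulr1 !mulrA.
Unshelve. all: by end_near. Qed.

(** The conclusion holds on a neighborhood and has the shape of the hypothesis,
so that it can be iterated to reach the higher derivatives. *)
Lemma cvg_series_derive1 c (f : K -> K) (z0 : K) :
  (\forall z \near z0, series (fun k => c k * (z - z0) ^+ k) @ \oo --> f z) ->
  \forall z \near z0,
    series (fun k => deriv_coef c k * (z - z0) ^+ k) @ \oo --> f^`() z.
Proof.
move=> cf; have [M [B [M0 B0 cMB]]] := dominated_of_cvg_series cf.
have cfB : \forall z \near z0, B * `|z - z0| <= 8^-1 /\
    series (fun k => c k * (z - z0) ^+ k) @ \oo --> f z.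
  near=> z; split; last by near: z.
  by near: z; apply: near_small_dist; rewrite ?(ltW B0)// invr_gt0.
have cfBB := near_join cfB.
near=> z.
have [Bz fz] : B * `|z - z0| <= 8^-1 /\
    series (fun k => c k * (z - z0) ^+ k) @ \oo --> f z by near: z.
have /cvg_ex[D cD] : cvgn (series (fun k => deriv_coef c k * (z - z0) ^+ k)).
  apply: (cvg_power_series _ _ (dominated_deriv_coef (ltW M0) (ltW B0) cMB)).
    by rewrite mulr_ge0// ltW.
  rewrite -mulrA -ler_pdivlMl// (le_trans Bz)// -invfM lef_pV2 ?posrE ?mulr_gt0//.
  by rewrite -natrM ler_nat.
suff -> : f^`() z = D by [].
rewrite /derive1; apply: cvg_lim => //; apply/cvgrPdist_le => e e0.
pose C := 2 * (M * (8 * B) ^+ 2).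
have C0 : 0 < C by rewrite !mulr_gt0 ?exprn_gt0 ?mulr_gt0.
have cfBh : \forall h \near (0 : K), B * `|z + h - z0| <= 8^-1 /\
    series (fun k => c k * (z + h - z0) ^+ k) @ \oo --> f (z + h).
  apply/(nbhs0P (fun y => B * `|y - z0| <= 8^-1 /\
    series (fun k => c k * (y - z0) ^+ k) @ \oo --> f y)).
  by near: z.
near=> h.
have h0 : h != 0 by near: h; exact: nbhs_dnbhs_neq.
have [Bzh fzh] : B * `|z + h - z0| <= 8^-1 /\
    series (fun k => c k * (z + h - z0) ^+ k) @ \oo --> f (z + h).
  by near: h; exact: nbhs_dnbhs.
rewrite [_ + h - z0]addrAC in Bzh fzh.
have fzh' : series (fun k => c k * (z - z0 + h) ^+ k) @ \oo --> f (z + h).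
  by move: fzh; under eq_fun do rewrite addrAC.
have := power_series_diff_quot_le B0 Bz Bzh cMB fz fzh' cD.
have -> : D - h^-1 *: (f (h + z) - f z) = - h^-1 * (f (z + h) - f z - h * D).
  by rewrite [h + z]addrC /GRing.scale/=; field.
rewrite normrM normrN normfV -/C => le_h.
rewrite ler_pdivrMl ?normr_gt0// (le_trans le_h)// exprSr mulrA expr1.
rewrite [leRHS]mulrC ler_wpM2r// mulrC -ler_pdivlMr// -[`|h|]mul1r -[h]subr0.
near: h; apply: nbhs_dnbhs; apply: near_small_dist => //; exact: divr_gt0.
Unshelve. all: by end_near. Qed.

End PowerSeries.

(** * Taylor coefficients *)

Section TaylorCoefficients.
Context {K : numFieldType} (K_cvg : cvg_of_dominated K).
Implicit Types (c : nat -> K) (f : K -> K) (z : K).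

Lemma iter_deriv_coef c k j :
  iter k deriv_coef c j *+ j`! = c (j + k)%N *+ (j + k)`!.
Proof.
elim: k j => [|k IHk] j /=; first by rewrite addn0.
by rewrite /deriv_coef -mulrnA -factS IHk addSnnS.
Qed.

Lemma cvg_series_derive1n c f (z0 : K) k :
  (\forall z \near z0, series (fun j => c j * (z - z0) ^+ j) @ \oo --> f z) ->
  \forall z \near z0,
    series (fun j => iter k deriv_coef c j * (z - z0) ^+ j) @ \oo -->
      derive1n k f z.
Proof. by move=> cf; elim: k => [|k IHk] //=; exact: cvg_series_derive1. Qed.

Lemma power_series_center c f (z0 : K) :
  (\forall z \near z0, series (fun j => c j * (z - z0) ^+ j) @ \oo --> f z) ->
  f z0 = c 0%N.
Proof.
move=> /nbhs_singleton cf.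
suff c0 : series (fun j => c j * (z0 - z0) ^+ j) @ \oo --> c 0%N.
  exact: (cvg_unique _ cf c0).
rewrite -cvg_shiftS; apply: cvg_near_cst; near=> N.
rewrite /series/= big_nat_recl//= expr0 mulr1 big1 ?addr0// => j _.
by rewrite subrr exprS mul0r mulr0.
Unshelve. all: by end_near. Qed.

Lemma taylor_coefE c f (z0 : K) k :
  (\forall z \near z0, series (fun j => c j * (z - z0) ^+ j) @ \oo --> f z) ->
  taylor_coef f z0 k = c k.
Proof.
move=> /(cvg_series_derive1n k)/power_series_center; rewrite /taylor_coef => ->.
have := iter_deriv_coef c k 0; rewrite fact0 mulr1n add0n => ->.
by rewrite -[_ *+ _]mulr_natr mulfK// pnatr_eq0 -lt0n fact_gt0.
Qed.

Lemma analytic_at_taylor f (z0 : K) : analytic_at f z0 ->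
  \forall z \near z0,
    series (fun k => taylor_coef f z0 k * (z - z0) ^+ k) @ \oo --> f z.
Proof.
move=> [c cf]; rewrite (_ : taylor_coef f z0 = c)//.
by apply/funext => k; exact: taylor_coefE.
Qed.

End TaylorCoefficients.

(** * Quotients of power series *)

Section QuotientCoefficients.

Section Algebra.
Context {F : fieldType}.
Implicit Types (c d : nat -> F).

(** Each coefficient of the formal quotient depends on all the previous ones,
which are therefore carried along as a list. *)
Fixpoint quotient_prefix c d n : seq F :=
  if n is m.+1 then
    let s := quotient_prefix c d m in
    rcons s ((c m - \sum_(j < m) s`_j * d (m - j)%N) / d 0%N)
  else [::].

Definition quotient_coef c d k := (quotient_prefix c d k.+1)`_k.

Lemma size_quotient_prefix c d n : size (quotient_prefix c d n) = n.
Proof. by elim: n => //= n IHn; rewrite size_rcons IHn. Qed.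

Lemma nth_quotient_prefix c d n j : (j < n)%N ->
  (quotient_prefix c d n)`_j = quotient_coef c d j.
Proof.
elim: n => // n IHn; rewrite ltnS leq_eqVlt => /orP[/eqP -> //|jn].
by rewrite /= nth_rcons size_quotient_prefix jn IHn.
Qed.

Lemma quotient_coefP c d k : d 0%N != 0 ->
  \sum_(j < k.+1) quotient_coef c d j * d (k - j)%N = c k.
Proof.
move=> d0; rewrite big_ord_recr/= subnn {2}/quotient_coef/=.
rewrite nth_rcons size_quotient_prefix ltnn eqxx divfK// addrC.
under [X in _ - X]eq_bigr do rewrite nth_quotient_prefix//.
by rewrite subrK.
Qed.

End Algebra.

Context {K : numFieldType}.
Implicit Types (c d h : nat -> K) (M B : K).

(** With [C = M / `|d 0|], the recurrence bounds [`|h k|] by [C * U k] for the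
weighted sum [U k] of the previous coefficients, and [U] itself grows at most
like a geometric sequence of ratio [B * (1 + C)]. *)
Lemma dominated_quotient c d h M B : 0 <= M -> 0 <= B -> d 0%N != 0 ->
  dominated c M B -> dominated d M B ->
  (forall k, \sum_(j < k.+1) h j * d (k - j)%N = c k) ->
  dominated h (M / `|d 0%N|) (B * (1 + M / `|d 0%N|)).
Proof.
move=> M0 B0 d0 cMB dMB hd; set C := M / _.
have C0 : 0 <= C by rewrite divr_ge0.
pose U k := B ^+ k + \sum_(j < k) B ^+ (k - j) * `|h j|.
have hU k : `|h k| <= C * U k.
  have -> : h k = (c k - \sum_(j < k) h j * d (k - j)%N) / d 0%N.
    by rewrite -hd big_ord_recr/= subnn addrAC subrr add0r mulfK.
  rewrite normrM normfV /C mulrAC ler_wpM2r ?invr_ge0//.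
  rewrite (le_trans (ler_normB _ _))// /U mulrDr lerD// mulr_sumr.
  rewrite (le_trans (ler_norm_sum _ _ _))// ler_sum// => j _.
  by rewrite normrM mulrC mulrA ler_wpM2r.
have US k : U k.+1 = B * (U k + `|h k|).
  rewrite /U big_ord_recr/= subSn// subnn expr1 exprS addrA !mulrDr mulr_sumr.
  by congr (_ + _ + _); apply: eq_bigr => j _; rewrite subSn 1?ltnW// exprS mulrA.
move=> k; apply: (le_trans (hU k)); rewrite ler_wpM2l//.
elim: k => [|k IHk]; first by rewrite /U big_ord0 addr0.
rewrite US exprS -mulrA ler_wpM2l//.
apply: (@le_trans _ _ (U k + C * U k)); first by rewrite lerD2l.
by rewrite -{1}[U k]mul1r -mulrDl ler_wpM2l ?addr_ge0.
Qed.

(** Grouping the terms of a partial sum of the Cauchy product by the index of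
[h] leaves partial sums of [d], for which a tail estimate is available. *)
Lemma cauchy_product_partial_sum c d h (w : K) N :
  (forall k, \sum_(j < k.+1) h j * d (k - j)%N = c k) ->
  series (fun k => c k * w ^+ k) N =
  \sum_(i < N) h i * w ^+ i * series (fun k => d k * w ^+ k) (N - i)%N.
Proof.
move=> hd; elim: N => [|N IHN]; first by rewrite /series/= big_geq// big_ord0.
rewrite seriesSr IHN -hd [in LHS]big_ord_recr [in RHS]big_ord_recr/=.
rewrite subnn subSn// subnn [series _ 1]/series/= big_nat1 expr0 mulr1.
rewrite mulrDl addrA; congr (_ + _); last by ring.
rewrite mulr_suml -big_split/=; apply: eq_bigr => i _.
rewrite subSn 1?ltnW// seriesSr mulrDr; congr (_ + _).
have -> : w ^+ N = w ^+ i * w ^+ (N - i) by rewrite -exprD subnKC 1?ltnW.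
by ring.
Qed.

Lemma cvg_half_expn : cvg_of_dominated K -> (2^-1 : K) ^+ n @[n --> \oo] --> 0.
Proof.
move=> /(_ (fun n => 2^-1 ^+ n) 1) K_cvg; apply: cvg_series_cvg_0; apply: K_cvg.
by move=> n; rewrite mul1r ger0_norm// exprn_ge0// invr_ge0.
Qed.

(** By [cauchy_product_partial_sum], the [N]-th partial sum of [h] times [G]
differs from the [N]-th partial sum of [c] by
[\sum_(i < N) h i * w ^+ i * (G - G_(N - i))], where [G_k] are the partial
sums of [d].  With [q = B * `|w|] each term is at most [2 * M ^+ 2 * q ^+ N],
and [N * q ^+ N] tends to 0. *)
Lemma power_series_quotient c d h M B (w F G H : K) : cvg_of_dominated K ->
  0 <= B -> B * `|w| <= 4^-1 -> dominated h M B -> dominated d M B ->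
  (forall k, \sum_(j < k.+1) h j * d (k - j)%N = c k) ->
  series (fun k => h k * w ^+ k) @ \oo --> H ->
  series (fun k => d k * w ^+ k) @ \oo --> G ->
  series (fun k => c k * w ^+ k) @ \oo --> F ->
  H * G = F.
Proof.
move=> K_cvg B0 Bw hMB dMB hd hH dG cF.
have M0 := dominated_ge0 dMB.
set q := B * `|w| in Bw.
have q0 : 0 <= q by rewrite mulr_ge0.
have q2 : q * 2 <= 2^-1.
  by rewrite -ler_pdivlMr// (le_trans Bw)// -invfM -natrM.
have q12 : q <= 2^-1 by rewrite (le_trans _ q2)// ler_peMr// ler1n.
pose HN := series (fun k => h k * w ^+ k).
pose FN := series (fun k => c k * w ^+ k).
have bound N : `|HN N * G - FN N| <= 2 * M ^+ 2 * (2^-1) ^+ N.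
  rewrite /FN (cauchy_product_partial_sum _ _ hd) /HN /series/= big_mkord.
  rewrite mulr_suml -sumrB (le_trans (ler_norm_sum _ _ _))//.
  apply: (@le_trans _ _ (\sum_(i < N) 2 * M ^+ 2 * q ^+ N)).
    apply: ler_sum => i _; rewrite -mulrBr normrM.
    have dt := power_series_tail_le (N - i)%N B0 q12 dMB dG.
    apply: (le_trans (ler_pM _ _ (dominated_geometric w hMB i) dt)) => //.
    rewrite le_eqVlt; apply/orP; left; apply/eqP.
    have -> : q ^+ N = q ^+ i * q ^+ (N - i) by rewrite -exprD subnKC 1?ltnW.
    by rewrite -/q; ring.
  (* The number [N] of terms is absorbed by [2 ^+ N]. *)
  rewrite sumr_const card_ord -[leLHS]mulr_natr -mulrA.
  rewrite ler_wpM2l ?mulr_ge0 ?exprn_ge0//.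
  rewrite (le_trans (ler_wpM2l (exprn_ge0 _ q0) (natr_le_2expn _)))//.
  by rewrite -exprMn lerXn2r// ?nnegrE ?mulr_ge0 ?invr_ge0.
have HG : HN N * G - FN N @[N --> \oo] --> H * G - F.
  by apply: cvgB => //; apply: cvgMl.
have HG0 : HN N * G - FN N @[N --> \oo] --> 0.
  apply/cvgr0Pnorm_le => e e0; near=> N; apply: (le_trans (bound N)).
  have h2 : `|(2^-1 : K) ^+ N| <= e / (2 * M ^+ 2 + 1).
    near: N; apply: cvgr0_norm_le; first exact: cvg_half_expn.
    by rewrite divr_gt0// ltr_wpDl// mulr_ge0// exprn_ge0.
  rewrite ger0_norm ?exprn_ge0 ?invr_ge0// in h2.
  have MM : 0 <= 2 * M ^+ 2 by rewrite mulr_ge0// exprn_ge0.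
  rewrite (le_trans (ler_wpM2l MM h2))// mulrCA ger_pMr//.
  by rewrite ler_pdivrMr ?ltr_wpDl// mul1r lerDl.
by apply/eqP; rewrite -subr_eq0; apply/eqP; exact: (cvg_unique _ HG HG0).
Unshelve. all: by end_near. Qed.

End QuotientCoefficients.

(** * Dominated series of complex numbers *)

Section ComplexCompleteness.
Local Open Scope complex_scope.
Context (R : realType).
Implicit Types (x : nat -> R[i]) (z : R[i]).

Lemma cvg_series_half_dominated (u : nat -> R) (m : R) :
  dominated u m 2^-1 -> cvgn (series u).
Proof.
move=> um; apply: (@normed_cvg _ R^o).
apply: (@series_le_cvg _ _ (geometric m 2^-1)) => //.
  by move=> k /=.
  by move=> k; exact: le_trans (normr_ge0 _) (um k).
by apply: is_cvg_geometric_series; rewrite ger0_norm ?invr_ge0// invf_lt1// ltr1n.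
Qed.

Lemma normc_realC (r : R) : `|r%:C| = `|r|%:C.
Proof. by rewrite normc_def/= expr0n addr0 sqrtr_sqr. Qed.

Lemma normc_le_ReIm z : `|z| <= `|complex.Re z|%:C + `|complex.Im z|%:C.
Proof.
rewrite {1}[z]complexE (le_trans (ler_normD _ _))// normrM !normc_realC.
by rewrite lerD2l normc_def/= expr0n add0r expr1n sqrtr1 mul1r.
Qed.

Lemma normc_ge_Im z : `|complex.Im z|%:C <= `|z|.
Proof. by rewrite normc_def lecR -sqrtr_sqr ler_wsqrtr// lerDr sqr_ge0. Qed.

(** The real and imaginary parts are dominated real series, and the modulus is
bounded by the sum of the absolute values of the two parts. *)
Lemma complexField_cvg_of_dominated : cvg_of_dominated (complexField R).
Proof.
move=> x M xM.
have M0 := dominated_ge0 xM.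
have {xM} xm k : `|x k : R[i]| <= (complex.Re M * 2^-1 ^+ k)%:C.
  have := xM k; rewrite -[M in X in X -> _](RRe_real (ger0_real M0)).
  by rewrite rmorphM rmorphXn fmorphV rmorph_nat.
have /cvg_ex[a ha] : cvgn (series (fun k => complex.Re (x k))).
  apply: (@cvg_series_half_dominated _ (complex.Re M)) => k.
  by rewrite -lecR (le_trans (normc_ge_Re _)).
have /cvg_ex[b hb] : cvgn (series (fun k => complex.Im (x k))).
  apply: (@cvg_series_half_dominated _ (complex.Re M)) => k.
  by rewrite -lecR (le_trans (normc_ge_Im _)).
have xE n : series x n = series (fun k => complex.Re (x k)) n +i*
                         series (fun k => complex.Im (x k)) n :> R[i].
  elim: n => [|n IHn]; first by rewrite /series/= !big_geq.
  by rewrite !seriesSr IHn; case: (x n).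
apply/cvg_ex; exists (a +i* b); apply/cvgrPdist_le => e e0.
have eE : e = (complex.Re e)%:C by rewrite (RRe_real (ger0_real (ltW e0))).
have e20 : 0 < complex.Re e / 2 by rewrite divr_gt0// -ltcR -eE.
near=> n; rewrite xE.
apply: (le_trans (normc_le_ReIm _)) => /=.
rewrite eE -rmorphD lecR [complex.Re e]splitr; apply: lerD.
  by near: n; apply: cvgr_dist_le.
by near: n; apply: cvgr_dist_le.
Unshelve. all: by end_near. Qed.

End ComplexCompleteness.

(** * Cramer's rule for the quotient coefficients *)

Section Cramer.
Context {F : fieldType}.
Implicit Types (c d h : nat -> F).

Definition quotient_mx c d n : 'M[F]_n.+1 :=
  \matrix_(i, j)
    if (j < n)%N then if (j <= i)%N then d (i - j)%N else 0 else c i.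

Lemma det_lower_toeplitz d n :
  \det (\matrix_(i < n, j < n) if (j <= i)%N then d (i - j)%N else 0) =
  d 0%N ^+ n.
Proof.
rewrite det_trig; last by apply/is_trig_mxP => i j ij; rewrite mxE leqNgt ij.
under eq_bigr do rewrite mxE leqnn subnn.
by rewrite prodr_const card_ord.
Qed.

(** The first [n + 1] equations of the recurrence say that the lower triangular
Toeplitz matrix of [d], multiplied by the identity matrix whose last column is
replaced by [h], is [quotient_mx c d n]. *)
Lemma det_quotient_mx c d h n :
  (forall k, \sum_(j < k.+1) h j * d (k - j)%N = c k) ->
  \det (quotient_mx c d n) = d 0%N ^+ n.+1 * h n.
Proof.
move=> hd.
pose T : 'M[F]_n.+1 := \matrix_(i, j) if (j <= i)%N then d (i - j)%N else 0.
pose E : 'M[F]_n.+1 := \matrix_(i, j) if (j < n)%N then (i == j)%:R else h i.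
have -> : quotient_mx c d n = T *m E.
  apply/matrixP => i j; rewrite !mxE; case: ifPn => jn.
    rewrite (bigD1 j)//= big1 => [|k kj]; last first.
      by rewrite !mxE jn (negbTE kj) mulr0.
    by rewrite !mxE jn eqxx mulr1 addr0.
  rewrite -hd; have iN : (i < n.+1)%N by [].
  rewrite (big_ord_widen n.+1 (fun j => h j * d (i - j)%N) iN) big_mkcond/=.
  apply: eq_bigr => k _; rewrite !mxE (negbTE jn) ltnS.
  by case: ifP => _; rewrite ?mul0r// mulrC.
rewrite det_mulmx det_lower_toeplitz -det_tr det_trig; last first.
  apply/is_trig_mxP => i j ij; rewrite !mxE.
  have -> : (i < n)%N by rewrite (leq_trans ij)// -ltnS.
  by rewrite -val_eqE/= gtn_eqF.
congr (_ * _); rewrite big_ord_recr/= big1 => [|i _].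
  by rewrite !mxE ltnn mul1r.
by rewrite !mxE/= ltn_ord eqxx.
Qed.

(** Deleting the last row and column leaves the Toeplitz matrix of size [n]. *)
Lemma cofactor_quotient_mx c d n :
  cofactor (quotient_mx c d n) ord_max ord_max = d 0%N ^+ n.
Proof.
rewrite /cofactor addnn -signr_odd odd_double expr0 mul1r.
rewrite -[RHS]det_lower_toeplitz; congr (\det _).
by apply/matrixP => i j; rewrite !mxE !lift_max ltn_ord.
Qed.

End Cramer.

(** * Laurent expansions from power series *)

Section Laurent.
Context {K : numFieldType}.
Implicit Types (h : nat -> K) (w f g : K -> K).

(** The coefficient of [(z - z0) ^ m] in [(z - z0) ^- n] times the power series
with coefficients [h]; [Negz k] stands for the index [- k.+1]. *)
Definition laurent_coef h n (m : int) : K :=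
  match m with
  | Posz k => h (n + k)%N
  | Negz k => if (k < n)%N then h (n - k.+1)%N else 0
  end.

(** Only the first [n] terms of the principal series can be nonzero; read backwards,
they are the first [n] terms of the power series divided by
[(z - z0) ^+ n]. *)
Lemma principal_seriesE h n (z0 z : K) N : (n <= N)%N -> z != z0 ->
  principal_series (laurent_coef h n) z0 z N =
  series (fun k => h k * (z - z0) ^+ k) n / (z - z0) ^+ n.
Proof.
move=> nN zz0; have w0 : z - z0 != 0 by rewrite subr_eq0.
rewrite /principal_series /series/= (big_cat_nat _ nN)//= addrC big1_seq ?add0r.
  rewrite !big_mkord mulr_suml [RHS](reindex_inj rev_ord_inj)/=.
  apply: eq_bigr => k _; rewrite ltn_ord -mulrA; congr (_ * _).
  have -> : (z - z0) ^+ n = (z - z0) ^+ (n - k.+1) * (z - z0) ^+ k.+1.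
    by rewrite -exprD subnK.
  by rewrite invfM mulrA mulfV ?mul1r// expf_neq0.
move=> k /=; rewrite mem_index_iota => /andP[nk _].
by rewrite ltnNge nk mul0r.
Qed.

Lemma principal_series_cvg h n (z0 z : K) : z != z0 ->
  principal_series (laurent_coef h n) z0 z @ \oo -->
  series (fun k => h k * (z - z0) ^+ k) n / (z - z0) ^+ n.
Proof.
move=> zz0; apply: cvg_near_cst; near=> N; apply: principal_seriesE => //.
by near: N; exact: nbhs_infty_ge.
Unshelve. all: by end_near. Qed.

Lemma laurent_expansion_of_power_series h w (z0 : K) n :
  (\forall z \near z0^',
    series (fun k => h k * (z - z0) ^+ k) @ \oo --> w z * (z - z0) ^+ n) ->
  laurent_expansion w z0 (laurent_coef h n).
Proof.
move=> hw; rewrite /laurent_expansion; near=> z.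
have zz0 : z != z0 by near: z; exact: nbhs_dnbhs_neq.
have Pz := principal_series_cvg (h := h) (n := n) zz0.
split; first by apply/cvg_ex; eexists; exact: Pz.
have wn0 : (z - z0) ^+ n != 0 by rewrite expf_neq0// subr_eq0.
rewrite /principal_part (cvg_lim _ Pz)//.
have -> : w z - series (fun k => h k * (z - z0) ^+ k) n / (z - z0) ^+ n =
    (w z * (z - z0) ^+ n - series (fun k => h k * (z - z0) ^+ k) n) /
    (z - z0) ^+ n.
  by rewrite mulrBl mulfK.
have -> : regular_series (laurent_coef h n) z0 z =
    fun N => (series (fun k => h k * (z - z0) ^+ k) (N + n)%N -
      series (fun k => h k * (z - z0) ^+ k) n) / (z - z0) ^+ n.
  apply/funext => N; rewrite /regular_series sub_series_geq ?leq_addl//.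
  rewrite /series/= mulr_suml -[X in index_iota X (N + n)]add0n.
  rewrite [in RHS]big_addn addnK.
  apply: eq_bigr => k _.
  by rewrite exprD mulrA mulfK// addnC.
apply: cvgMl; apply: cvgB; last exact: cvg_cst.
rewrite (cvg_shiftn n (series (fun k => h k * (z - z0) ^+ k))).
by near: z.
Unshelve. all: by end_near. Qed.

(** Off [z0], the function minus its principal part is the sum of the shifted
power series with coefficients [h (n + k)]. *)
Lemma is_reglim_of_power_series h M B w (z0 : K) n :
  0 <= B -> dominated h M B ->
  (\forall z \near z0^',
    series (fun k => h k * (z - z0) ^+ k) @ \oo --> w z * (z - z0) ^+ n) ->
  is_reglim w z0 (h n).
Proof.
move=> B0 hMB hw; have wL := laurent_expansion_of_power_series hw.
exists (laurent_coef h n) => //; rewrite -[n in h n]addn0.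
apply: (power_series_cvg_center B0 (dominated_shift n hMB)).
by near=> z; have [] : _ /\ _ := near wL z _.
Unshelve. all: by end_near. Qed.

Lemma pole_of_order_of_power_series h w (z0 : K) n : (0 < n)%N -> h 0%N != 0 ->
  (\forall z \near z0^',
    series (fun k => h k * (z - z0) ^+ k) @ \oo --> w z * (z - z0) ^+ n) ->
  pole_of_order w z0 n.
Proof.
move=> n0 h0 hw; split => //; exists (laurent_coef h n).
  exact: laurent_expansion_of_power_series.
case: n n0 {hw} => // n _; split=> [|[//|k]]; first by rewrite -NegzE/= ltnSn subnn.
by rewrite ltnS => nk; rewrite -NegzE/= ltnNge nk.
Qed.

End Laurent.

(** * The quotient of two analytic functions *)

Section Quotient.
Context {K : numFieldType} (K_cvg : cvg_of_dominated K).
Context (f g : K -> K) (z0 : K) (n : nat).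
Context (f_analytic : analytic_at f z0) (g_analytic : analytic_at g z0).
Context (g_order : zero_of_order g z0 n).

Let c := taylor_coef f z0.
Let d k := taylor_coef g z0 (n + k).
Let h := quotient_coef c d.

Lemma reduced_taylor_coef0_neq0 : d 0%N != 0.
Proof.
have [_ gn] := g_order; rewrite /d addn0 /taylor_coef mulf_neq0//.
by rewrite invr_eq0 pnatr_eq0 -lt0n fact_gt0.
Qed.

Lemma reduced_power_series : \forall z \near z0^',
  series (fun k => d k * (z - z0) ^+ k) @ \oo --> g z / (z - z0) ^+ n.
Proof.
have gT := analytic_at_taylor K_cvg g_analytic; near=> z.
have wn0 : (z - z0) ^+ n != 0.
  rewrite expf_neq0// subr_eq0; near: z; exact: nbhs_dnbhs_neq.
have -> : series (fun k => d k * (z - z0) ^+ k) = fun N =>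
    series (fun k => taylor_coef g z0 k * (z - z0) ^+ k) (N + n)%N / (z - z0) ^+ n.
  apply/funext => N; rewrite /series/= [in RHS](big_cat_nat (n := n))//= ?leq_addl//.
  rewrite [in RHS]big1_seq => [|k /=]; last first.
    rewrite mem_index_iota => /andP[_ kn]; have [gk _] := g_order.
    by rewrite /taylor_coef gk// !mul0r.
  rewrite add0r -[X in index_iota X (N + n)]add0n [in RHS]big_addn addnK.
  rewrite mulr_suml; apply: eq_bigr => k _.
  by rewrite exprD mulrA mulfK// addnC.
apply: cvgMl.
rewrite (cvg_shiftn n (series (fun k => taylor_coef g z0 k * (z - z0) ^+ k))).
by near: z; exact: nbhs_dnbhs.
Unshelve. all: by end_near. Qed.

(** The reduced denominator [g z / (z - z0) ^+ n] tends to [d 0 != 0], so it does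
not vanish near [z0], and dividing by it turns the product identity
[power_series_quotient] into the value of [f / g]. *)
Lemma quotient_power_series : exists M B, [/\ 0 <= B, dominated h M B &
  \forall z \near z0^', series (fun k => h k * (z - z0) ^+ k) @ \oo -->
    f z / g z * (z - z0) ^+ n].
Proof.
have fT := analytic_at_taylor K_cvg f_analytic.
have gT := analytic_at_taylor K_cvg g_analytic.
have gn := reduced_power_series; have d0 := reduced_taylor_coef0_neq0.
have [M1 [B1 [M10 B10 cM1]]] := dominated_of_cvg_series fT.
have [M2 [B2 [M20 B20 gM2]]] := dominated_of_cvg_series gT.
have dM2 : dominated d (M2 * B2 ^+ n) B2 by exact: dominated_shift.
have M2n0 : 0 < M2 * B2 ^+ n by rewrite mulr_gt0 ?exprn_gt0.
set M2n := M2 * _ in dM2 M2n0.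
have hd k : \sum_(j < k.+1) h j * d (k - j)%N = c k by exact: quotient_coefP.
have cMB : dominated c (M1 + M2n) (B1 + B2).
  by apply: dominatedW cM1; rewrite ?lerDl ?ltW.
have dMB : dominated d (M1 + M2n) (B1 + B2).
  by apply: dominatedW dM2; rewrite ?lerDr ?ltW.
have MD0 : 0 <= M1 + M2n by rewrite addr_ge0 ?ltW.
have BD0 : 0 <= B1 + B2 by rewrite addr_ge0 ?ltW.
have hMB := dominated_quotient MD0 BD0 d0 cMB dMB hd.
set M3 := _ / _ in hMB; set B3 := _ * _ in hMB.
have M30 : 0 <= M3 by rewrite divr_ge0.
have B30 : 0 <= B3 by rewrite mulr_ge0// addr_ge0.
pose M := M1 + M2n + M3; pose B := B1 + B2 + B3.
have B0 : 0 <= B by rewrite addr_ge0.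
have hM : dominated h M B by apply: dominatedW hMB; rewrite ?lerDr.
have dM : dominated d M B by apply: dominatedW dMB; rewrite ?lerDl.
exists M, B; split => //.
have g_neq0 : \forall z \near z0^', g z / (z - z0) ^+ n != 0.
  exact: cvgr_neq0 (power_series_cvg_center B0 dM gn) d0.
near=> z.
have gz : g z / (z - z0) ^+ n != 0 by near: z.
have Bz : B * `|z - z0| <= 4^-1.
  by near: z; apply: nbhs_dnbhs; apply: near_small_dist; rewrite ?invr_gt0.
have /cvg_ex[H hH] : cvgn (series (fun k => h k * (z - z0) ^+ k)).
  apply: (cvg_power_series K_cvg B0 _ hM); rewrite (le_trans Bz)//.
  by rewrite lef_pV2 ?posrE// ler_nat.
have HG : H * (g z / (z - z0) ^+ n) = f z.
  apply: (power_series_quotient K_cvg B0 Bz hM dM hd hH); first by near: z.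
  by near: z; exact: nbhs_dnbhs.
suff <- : H = f z / g z * (z - z0) ^+ n by [].
have [gz0 wz0] : g z != 0 /\ (z - z0) ^+ n != 0.
  by move: gz; rewrite mulf_eq0 invr_eq0 negb_or => /andP[].
by rewrite -HG; field; rewrite gz0.
Unshelve. all: by end_near. Qed.

End Quotient.

Lemma Delta_quotient_mx (K : numFieldType) (f g : K -> K) (z0 : K) n :
  Delta f g z0 n =
  quotient_mx (taylor_coef f z0) (fun k => taylor_coef g z0 (n + k)) n.
Proof.
apply/matrixP => i j; rewrite !mxE; case: ifP => // _.
by case: ifP => // ji; rewrite addnBA.
Qed.

Theorem theorem3p1 (R : realType) (f g : complexField R -> complexField R)
    (z0 : complexField R) (n : nat)
    (f_analytic : analytic_at f z0) (g_analytic : analytic_at g z0)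
    (f_neq0 : f z0 != 0) (g_eq0 : g z0 = 0) (g_order : zero_of_order g z0 n) :
  [/\ pole_of_order (fun z => f z / g z) z0 n,
      is_reglim (fun z => f z / g z) z0
        (((n`!)%:R / derive1n n g z0) ^+ n.+1 * \det (Delta f g z0 n)) &
      is_reglim (fun z => f z / g z) z0
        (derive1n n f z0 / derive1n n g z0 +
         ((n`!)%:R / derive1n n g z0) ^+ n.+1 *
         \sum_(k < n) taylor_coef f z0 k *
           cofactor (Delta f g z0 n) (widen_ord (leqnSn n) k) ord_max)].
Proof.
have K_cvg := @complexField_cvg_of_dominated R.
have n_gt0 : (0 < n)%N.
  by case: n g_order => // -[_]; rewrite /= g_eq0 eqxx.
have d0 := reduced_taylor_coef0_neq0 g_order.
have [M [B [B0 hMB hw]]] :=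
  quotient_power_series K_cvg f_analytic g_analytic g_order.
have hd k := @quotient_coefP _ (taylor_coef f z0)
  (fun k => taylor_coef g z0 (n + k)) k d0.
have fact_neq0 : (n`!)%:R != 0 :> complexField R by rewrite pnatr_eq0 -lt0n fact_gt0.
have dgE : (n`!)%:R / derive1n n g z0 = (taylor_coef g z0 (n + 0))^-1.
  by rewrite addn0 /taylor_coef invfM invrK mulrC.
have detE : ((n`!)%:R / derive1n n g z0) ^+ n.+1 * \det (Delta f g z0 n) =
    quotient_coef (taylor_coef f z0) (fun k => taylor_coef g z0 (n + k)) n.
  rewrite dgE Delta_quotient_mx (det_quotient_mx n hd) mulrA -exprMn mulVf//.
  by rewrite expr1n mul1r.
split.
- apply: pole_of_order_of_power_series n_gt0 _ hw.
  have := hd 0%N; rewrite big_ord1 => h0; apply: contra_neq f_neq0 => h00.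
  by move: h0; rewrite h00 mul0r /taylor_coef/= fact0 divr1.
- by rewrite detE; exact: is_reglim_of_power_series B0 hMB hw.
- have -> : derive1n n f z0 / derive1n n g z0 +
      ((n`!)%:R / derive1n n g z0) ^+ n.+1 *
      \sum_(k < n) taylor_coef f z0 k *
        cofactor (Delta f g z0 n) (widen_ord (leqnSn n) k) ord_max =
      ((n`!)%:R / derive1n n g z0) ^+ n.+1 * \det (Delta f g z0 n).
    rewrite (expand_det_col _ ord_max) big_ord_recr/= mulrDr addrC; congr (_ + _).
      by congr (_ * _); apply: eq_bigr => k _; rewrite mxE ltnn.
    rewrite mxE ltnn Delta_quotient_mx cofactor_quotient_mx dgE exprSr.
    rewrite [RHS]mulrCA [X in _ = _ * X]mulrAC -exprMn mulVf// expr1n mul1r.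
    by rewrite -dgE /taylor_coef; field; rewrite fact_neq0 g_order.2.
  by rewrite detE; exact: is_reglim_of_power_series B0 hMB hw.
Qed.
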